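(* For every positive integer $n$ and every real number $r \geq 1$, $$\sum_{x=1}^{n} x^{\frac{1}{r}} = \frac{r}{r+1}(n+1)^{\frac{1+r}{r}} - \frac{1}{2}(n+1)^{\frac{1}{r}} - \phi_n(r),$$ where $\phi_n$ is a function of $r \in [1,\infty)$ (with $n$ as a parameter) that is bounded between $0$ and $\frac{1}{2}$, i.e. $0 \leq \phi_n(r) \leq \frac{1}{2}$ for all real $r \geq 1$.
   Context: The sum is over the integers $x = 1, \dots, n$, and all powers are real powers of positive reals. The displayed identity determines $\phi_n(r)$, so the content is the bound on $\phi_n(r)$. *)

(* Defs.v *)
From Stdlib Require Export Reals.

(* Main.v *)
Require Import Defs.
From Stdlib Require Import Reals Lra Lia.
Open Scope R_scope.

(** Put [a = 1 / r], so that [0 < a <= 1], and consider the concave function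
    [f x = x ^ a] with primitive [F x = x ^ (1 + a) / (1 + a)] and derivative
    [g x = a * x ^ (a - 1)]. The remainder is forced to be
    [phi_n = F (n + 1) - f (n + 1) / 2 - (f 1 + ... + f n)].
    Its value at [n = 0] is [1 / (1 + a) - 1 / 2], and [phi_n - phi_(n - 1)] is
    the error of the trapezoidal rule for [f] on the interval from [n] to
    [n + 1]. Concavity makes this error nonnegative, whence
    [phi_n >= 1 / (1 + a) - 1 / 2 >= 0]. It is also at most
    [(g n - g (n + 1)) / 2] ([trapezoid_error_bounds]), and these upper bounds
    telescope ([trapezoid_sum_bounds]), so that
    [phi_n <= 1 / (1 + a) - 1 / 2 + a / 2]. The right-hand side is at most
    [1 / 2] because [a ^ 2 <= a]. *)

Lemma nonneg_deriv_increment (h h' : R -> R) (x y : R) :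
  x < y ->
  (forall c, x <= c <= y -> derivable_pt_lim h c (h' c)) ->
  (forall c, x <= c <= y -> 0 <= h' c) ->
  h x <= h y.
Proof.
  intros Hxy Hd Hp.
  destruct (MVT_cor2 h h' x y Hxy Hd) as [c [Hc Hxcy]].
  assert (0 <= h' c * (y - x)) by (apply Rmult_le_pos; [apply Hp |]; lra).
  lra.
Qed.

Section Concave.

Variables F f g : R -> R.
Hypothesis F_deriv : forall x, 0 < x -> derivable_pt_lim F x (f x).
Hypothesis f_deriv : forall x, 0 < x -> derivable_pt_lim f x (g x).
Hypothesis g_decr : forall x y, 0 < x -> x <= y -> g y <= g x.

Lemma concave_increment_bounds (x y : R) :
  0 < x -> x <= y -> (y - x) * g y <= f y - f x <= (y - x) * g x.
Proof.
  intros Hx [Hxy | <-]; [| lra].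
  destruct (MVT_cor2 f g x y Hxy) as [c [-> Hc]].
  { intros c Hc; apply f_deriv; lra. }
  assert (g y <= g c) by (apply g_decr; lra).
  assert (g c <= g x) by (apply g_decr; lra).
  split; nra.
Qed.

(** The trapezoidal error over the interval from [x] to [s] has derivative
    [(f s - f x - (s - x) * g s) / 2] in [s], which is nonnegative because the
    graph of [f] lies below its tangent at [s]. *)
Lemma trapezoid_le_integral (x y : R) :
  0 < x -> x < y -> (y - x) * (f x + f y) / 2 <= F y - F x.
Proof.
  intros Hx Hxy.
  set (h := (F - mult_real_fct (/ 2)
                   ((id - fct_cte x) * (fct_cte (f x) + f)))%F).
  set (h' := fun s => f s - / 2 *
                ((1 - 0) * (f x + f s) + (s - x) * (0 + g s))).
  assert (Hh : h x <= h y).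
  { apply (nonneg_deriv_increment h h'); [exact Hxy | |].
    - intros c Hc; unfold h, h'.
      apply derivable_pt_lim_minus; [apply F_deriv; lra |].
      apply derivable_pt_lim_scal.
      apply (derivable_pt_lim_mult (id - fct_cte x)%F (fct_cte (f x) + f)%F).
      + apply derivable_pt_lim_minus;
          [apply derivable_pt_lim_id | apply derivable_pt_lim_const].
      + apply derivable_pt_lim_plus;
          [apply derivable_pt_lim_const | apply f_deriv; lra].
    - intros c Hc; unfold h'.
      destruct (concave_increment_bounds x c) as [H _]; lra. }
  unfold h, mult_real_fct, minus_fct, mult_fct, plus_fct, fct_cte, id in Hh.
  lra.
Qed.

(** The graph of [f] lies below its tangent at [x], and the right-hand side is
    the integral of that tangent. *)
Lemma integral_le_tangent (x y : R) :
  0 < x -> x < y -> F y - F x <= (y - x) * f x + (y - x) ^ 2 / 2 * g x.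
Proof.
  intros Hx Hxy.
  set (h := (mult_real_fct (f x) (id - fct_cte x)
             + mult_real_fct (g x / 2) ((id - fct_cte x) * (id - fct_cte x))
             - F)%F).
  set (h' := fun s => f x * (1 - 0)
                + g x / 2 * ((1 - 0) * (s - x) + (s - x) * (1 - 0)) - f s).
  assert (Hl : forall c, derivable_pt_lim (id - fct_cte x)%F c (1 - 0)).
  { intros c; apply derivable_pt_lim_minus;
      [apply derivable_pt_lim_id | apply derivable_pt_lim_const]. }
  assert (Hh : h x <= h y).
  { apply (nonneg_deriv_increment h h'); [exact Hxy | |].
    - intros c Hc; unfold h, h'.
      apply derivable_pt_lim_minus; [| apply F_deriv; lra].
      apply derivable_pt_lim_plus; apply derivable_pt_lim_scal; [apply Hl |].
      apply (derivable_pt_lim_mult (id - fct_cte x)%F (id - fct_cte x)%F);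
        apply Hl.
    - intros c Hc; unfold h'.
      destruct (concave_increment_bounds x c) as [_ H]; lra. }
  unfold h, mult_real_fct, minus_fct, mult_fct, plus_fct, fct_cte, id in Hh.
  lra.
Qed.

(** For the upper bound, compare the integral with the tangent at [x], which
    gives [f x + g x / 2], and the trapezoid with [f (x + 1) >= f x + g (x + 1)].
    The constant [1 / 2] is not optimal, but it makes the bound telescope. *)
Lemma trapezoid_error_bounds (x : R) :
  0 < x ->
  0 <= F (x + 1) - F x - (f x + f (x + 1)) / 2 <= (g x - g (x + 1)) / 2.
Proof.
  intros Hx.
  assert (H1 := trapezoid_le_integral x (x + 1) Hx ltac:(lra)).
  assert (H2 := integral_le_tangent x (x + 1) Hx ltac:(lra)).
  destruct (concave_increment_bounds x (x + 1)) as [H3 _]; [lra | lra |].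
  replace (x + 1 - x) with 1 in * by ring.
  lra.
Qed.

Lemma trapezoid_sum_bounds (m : nat) :
  F 1 - f 1 / 2
  <= F (INR m + 2) - f (INR m + 2) / 2 - sum_f_R0 (fun k => f (INR (k + 1))) m
  <= F 1 - f 1 / 2 + (g 1 - g (INR m + 2)) / 2.
Proof.
  induction m as [| m IH].
  - simpl.
    assert (H := trapezoid_error_bounds 1 ltac:(lra)).
    replace (0 + 2) with (1 + 1) by ring.
    lra.
  - assert (Hm := pos_INR m).
    assert (H := trapezoid_error_bounds (INR m + 2) ltac:(lra)).
    rewrite tech5, S_INR.
    replace (INR (S m + 1)) with (INR m + 2)
      by (rewrite plus_INR, S_INR; simpl; ring).
    replace (INR m + 1 + 2) with (INR m + 2 + 1) by ring.
    lra.
Qed.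

End Concave.

Lemma Rpower_nonpos_exponent_decr (b x y : R) :
  b <= 0 -> 0 < x -> x <= y -> Rpower y b <= Rpower x b.
Proof.
  intros Hb Hx Hxy.
  rewrite <- (Ropp_involutive b), 2!(Rpower_Ropp _ (- b)).
  apply Rinv_le_contravar; [apply exp_pos |].
  apply Rle_Rpower_l; lra.
Qed.

Lemma Rpower_primitive_deriv (a x : R) :
  0 < 1 + a -> 0 < x ->
  derivable_pt_lim (fun t => / (1 + a) * Rpower t (1 + a)) x (Rpower x a).
Proof.
  intros Ha Hx.
  replace (Rpower x a)
    with (/ (1 + a) * ((1 + a) * Rpower x (1 + a - 1))).
  - apply (derivable_pt_lim_scal (fun t => Rpower t (1 + a))).
    apply derivable_pt_lim_power; exact Hx.
  - replace (1 + a - 1) with a by ring; field; lra.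
Qed.

(** The bounds [0] and [1 / 2] hold because [1 / (1 + a)] lies between [1 / 2]
    and [1 - a / 2] when [0 <= a <= 1]. *)
Lemma power_sum_remainder_bounds (a : R) (m : nat) :
  0 <= a <= 1 ->
  0 <= / (1 + a) * Rpower (INR m + 2) (1 + a) - Rpower (INR m + 2) a / 2
       - sum_f_R0 (fun k => Rpower (INR (k + 1)) a) m
    <= 1 / 2.
Proof.
  intros Ha.
  assert (HB := trapezoid_sum_bounds
    (fun t => / (1 + a) * Rpower t (1 + a))
    (fun t => Rpower t a) (fun t => a * Rpower t (a - 1))).
  specialize (HB (fun x => Rpower_primitive_deriv a x ltac:(lra))).
  specialize (HB (fun x Hx => derivable_pt_lim_power x a Hx)).
  assert (Hg : forall x y, 0 < x -> x <= y ->
                 a * Rpower y (a - 1) <= a * Rpower x (a - 1)).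
  { intros x y Hx Hxy; apply Rmult_le_compat_l; [lra |].
    apply Rpower_nonpos_exponent_decr; lra. }
  specialize (HB Hg m); cbv beta in HB.
  assert (H1 : forall b, Rpower 1 b = 1)
    by (intros b; unfold Rpower; rewrite ln_1, Rmult_0_r; apply exp_0).
  rewrite !H1 in HB.
  assert (Hpos : 0 <= a * Rpower (INR m + 2) (a - 1))
    by (apply Rmult_le_pos; [lra | left; apply exp_pos]).
  assert (Hinv : (1 + a) * / (1 + a) = 1) by (apply Rinv_r; lra).
  assert (Hlow : 1 / 2 <= / (1 + a)) by nra.
  assert (Hup : / (1 + a) <= 1 - a / 2) by nra.
  lra.
Qed.

Theorem theorem0p1 (n : nat) (hn : (1 <= n)%nat) :
  exists phi : R -> R,
    forall r : R, 1 <= r ->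
      sum_f 1 n (fun x : nat => Rpower (INR x) (1 / r)) =
        r / (r + 1) * Rpower (INR n + 1) ((1 + r) / r)
        - 1 / 2 * Rpower (INR n + 1) (1 / r)
        - phi r
      /\ 0 <= phi r <= 1 / 2.
Proof.
  exists (fun r => r / (r + 1) * Rpower (INR n + 1) ((1 + r) / r)
                   - 1 / 2 * Rpower (INR n + 1) (1 / r)
                   - sum_f 1 n (fun x : nat => Rpower (INR x) (1 / r))).
  intros r Hr; split; [ring |].
  assert (Ha : 0 <= 1 / r <= 1).
  { split; [apply Rle_mult_inv_pos; lra |].
    apply Rmult_le_reg_r with r; [lra |].
    replace (1 / r * r) with 1 by (field; lra); lra. }
  assert (HB := power_sum_remainder_bounds (1 / r) (n - 1) Ha).
  unfold sum_f.
  replace (r / (r + 1)) with (/ (1 + 1 / r)) by (field; lra).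
  replace ((1 + r) / r) with (1 + 1 / r) by (field; lra).
  replace (INR n + 1) with (INR (n - 1) + 2)
    by (rewrite minus_INR by exact hn; simpl; ring).
  lra.
Qed.
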